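(* Let $(F,d_F)$ be a metric space and let $f:\mathfrak{S}_\infty\to F$. Let $(\sigma_n)_{n\ge1}$ and $(\sigma_{ref,n})_{n\ge1}$ be two conjugation invariant sequences of random permutations. Suppose that there exists $x\in F$ such that, as $n\to\infty$, (i) $f(\sigma_{ref,n})\to x$ in probability; (ii) $\varepsilon'_{n,\#(\sigma_{ref,n})}(f)\to 0$ in probability; (iii) $\varepsilon'_{n,\#(\sigma_{n})}(f)\to 0$ in probability. Then $f(\sigma_n)\to x$ in probability. Moreover, if for some $p\ge 1$ the convergences (i), (ii) and (iii) hold in $\mathbb{L}^p$ instead of in probability, then $f(\sigma_n)\to x$ in $\mathbb{L}^p$.
   Context: $\mathfrak{S}_n$ is the group of permutations of $\{1,\dots,n\}$, $\mathfrak{S}_\infty:=\cup_{n\ge1}\mathfrak{S}_n$, and $\#(\sigma)$ is the number of cycles of $\sigma$ (fixed points included). A sequence of random permutations $(\sigma_n)_{n\ge1}$ is conjugation invariant if, for all $n\ge1$, $\sigma_n$ takes values in $\mathfrak{S}_n$ and for every $\sigma\in\mathfrak{S}_n$, $\sigma^{-1}\sigma_n\sigma$ has the same distribution as $\sigma_n$. For $E\subset\mathfrak{S}_n$ set $\mathrm{next}(E):=\{\rho\circ(i,j):\rho\in E,\ \#(\rho\circ(i,j))=\#(\rho)-1\}\cup\{\rho\in E:\#(\rho)=1\}$, where $(i,j)$ denotes a transposition. For $\sigma\in\mathfrak{S}_n$ set $\mathrm{final}(\sigma):=\mathrm{next}^{\#(\sigma)-1}(\{\sigma\})$ if $\#(\sigma)>1$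 (iterating $\mathrm{next}$ $\#(\sigma)-1$ times) and $\mathrm{final}(\sigma):=\{\sigma\}$ otherwise. For $1\le k\le n$, $$\varepsilon'_{n,k}(f):=\max_{\sigma\in\mathfrak{S}_n,\ \#(\sigma)=k}\ \max_{\rho\in\mathrm{final}(\sigma)} d_F(f(\sigma),f(\rho)).$$ For $F$-valued random variables, $Y_n\to x$ in probability means $d_F(Y_n,x)\to0$ in probability, and $Y_n\to x$ in $\mathbb{L}^p$ means $d_F(Y_n,x)\to 0$ in $\mathbb{L}^p$. *)

(* Defs.v *)
From HB Require Import structures.
From mathcomp Require Import all_boot all_order all_algebra all_fingroup.
From mathcomp Require Import all_classical all_reals all_analysis.

Set Implicit Arguments.
Unset Strict Implicit.
Unset Printing Implicit Defensive.

Import Order.TTheory GRing.Theory Num.Theory.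
Import numFieldNormedType.Exports.

Local Open Scope classical_set_scope.
Local Open Scope ring_scope.

(* Every finite symmetric group carries its discrete sigma-algebra, so that a
   random permutation is an element of {mfun T >-> 'S_n}. *)
HB.instance Definition _ (T : finType) :=
  isPointed.Build (perm_type T) (1%g : {perm T}).

HB.instance Definition _ (T : finType) :=
  @isMeasurable.Build default_measure_display (perm_type T)
  (@discrete_measurable (perm_type T)) (@discrete_measurable0 _)
    (@discrete_measurableC _) (@discrete_measurableU _).

(* In MathComp (s * t)%g is "s first, then t", hence the swap. *)
Definition compp (n : nat) (s t : 'S_n) : 'S_n := (t * s)%g.

Lemma comppE (n : nat) (s t : 'S_n) : compp s t =1 s \o t.
Proof. by move=> i; rewrite /compp permM. Qed.

(* porbits also contains the singleton orbits, i.e. the fixed points. *)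
Definition ncycles (n : nat) (s : 'S_n) : nat := #|porbits s|.

Definition next (n : nat) (E : {set 'S_n}) : {set 'S_n} :=
  [set s | [exists rho in E, exists i, exists j,
      [&& i != j, s == compp rho (tperm i j)
        & ncycles s == (ncycles rho).-1]]]
  :|: [set rho in E | ncycles rho == 1%N].

Definition final (n : nat) (s : 'S_n) : {set 'S_n} :=
  if (1 < ncycles s)%N then iter (ncycles s).-1 (@next n) [set s]%SET
  else [set s]%SET.

(* The default value 0 of the maxima is immaterial: distances are nonnegative,
   and for 1 <= k <= n both index sets are nonempty. A function on the union of
   the S_n, n >= 1, is a family (f n); the value at n = 0 plays no role. *)
Definition eps' (R : realType) (F : metricType R) (f : forall n, 'S_n -> F)
    (n k : nat) : R :=
  \big[Num.max/0]_(s : 'S_n | ncycles s == k)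
    \big[Num.max/0]_(rho in final s) mdist (f n s) (f n rho).

(* The n-th random permutation may live on its own probability space. *)
Definition conj_invariant (R : realType) (d : nat -> measure_display)
    (T : forall n, measurableType (d n)) (P : forall n, probability (T n) R)
    (sigma : forall n, {mfun T n >-> 'S_n}) : Prop :=
  forall n, (0 < n)%N -> forall s : 'S_n,
    pushforward (P n) (fun w => compp (compp s^-1%g (sigma n w)) s)
    = distribution (P n) (sigma n).

Definition cvg0_in_prob (R : realType) (d : nat -> measure_display)
    (T : forall n, measurableType (d n)) (P : forall n, probability (T n) R)
    (Y : forall n, T n -> R) : Prop :=
  forall e : R, 0 < e ->
    (fun n => P n [set w | `|Y n w| > e]) @ \oo --> 0%E.

Definition cvg0_in_Lp (R : realType) (d : nat -> measure_display)
    (T : forall n, measurableType (d n)) (P : forall n, probability (T n) R)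
    (p : R) (Y : forall n, T n -> R) : Prop :=
  (fun n => 'N[P n]_(p%:E)[EFin \o Y n])%E @ \oo --> 0%E.

(* Main.v *)
Require Import Defs.
From HB Require Import structures.
From mathcomp Require Import all_boot all_order all_algebra all_fingroup.
From mathcomp Require Import all_classical all_reals all_analysis.
From mathcomp Require Import measurable_realfun lra.

Set Implicit Arguments.
Unset Strict Implicit.
Unset Printing Implicit Defensive.

Import Order.TTheory GRing.Theory Num.Theory.
Import numFieldNormedType.Exports.

Local Open Scope classical_set_scope.
Local Open Scope ring_scope.

(** The theorem holds because every conjugation invariant random permutation
    can be turned into the same object, a uniform full cycle, by merging its
    cycles one at a time.

    Fix n > 0. A permutation with k cycles reaches a full cycle after k - 1
    merging transpositions, so [final s] is a nonempty set of full cycles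
    ([final_neq0], [final_full_cycle]), and the construction commutes with
    conjugation ([finalJ]). If s is random with a conjugation invariant law and
    r is drawn uniformly from [final s], then the law of r is conjugation
    invariant and carried by the full cycles; these form one conjugacy class
    ([full_cycle_conj]), so r is uniform on them, whatever the law of s
    ([sum_mass_final_kernel]).

    Two conjugation invariant laws q and q' can therefore be glued along r: the
    formula [final_coupling] is a coupling of q and q' that charges only pairs
    (s, s') for which [final s] and [final s'] share a permutation r. On such a
    pair the triangle inequality through f r gives
      d(f s, x) <= eps'(#s) + eps'(#s') + d(f s', x)
    ([mdist_common_final]). Hence an inequality g s <= c (h s + l s' + m s')
    valid on these pairs integrates to one between expectations, where g and h
    are evaluated at sigma_n, l and m at sigma_ref,n ([integral_transfer]).
    For convergence in probability it is applied to indicators of {. > eta} and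
    {. > eta / 3}; for convergence in L^p, to p-th powers with c = 3^p. *)

(** * Cycles and conjugation *)

Lemma porbitJ (T : finType) (s t : {perm T}) (x : T) :
  porbit (s ^ t)%g (t x) = (t @: porbit s x)%SET.
Proof.
apply/setP=> y; apply/idP/imsetP => [/porbitP[i ->]|[z /porbitP[i ->] ->]].
  by exists ((s ^+ i)%g x); [exact: mem_porbit | rewrite -conjXg permJ].
by rewrite -permJ conjXg mem_porbit.
Qed.

Lemma porbitsJ (T : finType) (s t : {perm T}) :
  porbits (s ^ t)%g = ((fun A : {set T} => t @: A) @: porbits s)%SET.
Proof.
apply/setP=> A; apply/imsetP/imsetP => [[y _ ->]|[B /imsetP[x _ ->] ->]].
  exists (porbit s (t^-1%g y)); first exact: imset_f.
  by rewrite -porbitJ permKV.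
by exists (t x); rewrite // porbitJ.
Qed.

Lemma ncyclesJ (n : nat) (s t : 'S_n) : ncycles (s ^ t)%g = ncycles s.
Proof.
by rewrite /ncycles porbitsJ card_imset//; apply: imset_inj; apply: perm_inj.
Qed.

(** * Full cycles *)

Lemma full_cycle_porbit (n : nat) (s : 'S_n) (x y : 'I_n) :
  ncycles s = 1%N -> y \in porbit s x.
Proof.
move=> /eqP/cards1P[A sA]; rewrite -eq_porbit_mem.
have m z : porbit s z = A.
  by apply/set1P; rewrite -sA; exact: imset_f.
by rewrite !m.
Qed.

(** The orbit of x under a full cycle has exactly n points, so it returns to x
    with exact period n. The right-hand side does not mention s: this is what
    makes the conjugating map between two full cycles well defined. *)
Lemma full_cycle_expg_eq (n : nat) (s : 'S_n) (x : 'I_n) (a b : nat) :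
  ncycles s = 1%N ->
  ((s ^+ a)%g x == (s ^+ b)%g x) = (a == b %[mod n]).
Proof.
move=> s1; have cs : #|porbit s x| = n.
  rewrite -[RHS](card_ord n); apply: eq_card => y.
  by rewrite full_cycle_porbit.
have xn : iter n s x = x by move: (iter_porbit s x); rewrite cs.
have n0 : (0 < n)%N by case: n x {s s1 cs xn} => [[]|].
have red c : (s ^+ c)%g x = nth x (traject s x n) (c %% n).
  rewrite nth_traject ?ltn_pmod// {1}(divn_eq c n) mulnC addnC permX iterD.
  congr (iter _ _ _).
  elim: (c %/ n)%N => [|k IH]; first by rewrite muln0.
  by rewrite mulnS iterD IH.
rewrite !red nth_uniq ?size_traject ?ltn_pmod//.
by move: (uniq_traject_porbit s x); rewrite cs.
Qed.

(** The full cycles form a single conjugacy class: conjugate by the bijection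
    that sends s^k 0 to s'^k 0. *)
Lemma full_cycle_conj (n : nat) (s s' : 'S_n) :
  ncycles s = 1%N -> ncycles s' = 1%N -> exists t : 'S_n, s' = (s ^ t)%g.
Proof.
case: n s s' => [|n] s s' s1 s1'.
  by exists 1%g; apply/permP => -[].
(* Every x is (s^k x) 0 for some exponent k x, unique modulo n. *)
have /fin_all_exists[k kE] : forall x : 'I_n.+1, exists k, x = (s ^+ k)%g ord0.
  by move=> x; have /porbitP := full_cycle_porbit ord0 x s1.
pose u x := (s' ^+ k x)%g ord0.
have uinj : injective u.
  move=> x y /eqP; rewrite full_cycle_expg_eq// => kxy.
  by apply/eqP; rewrite (kE x) (kE y) full_cycle_expg_eq.
exists (perm uinj); apply/permP => y.
rewrite -(permKV (perm uinj) y); set x := (perm uinj)^-1%g y.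
rewrite permJ !permE /u -permM -expgSr; apply/eqP.
rewrite full_cycle_expg_eq// -(full_cycle_expg_eq ord0 _ _ s1) -kE.
by rewrite expgSr permM -kE.
Qed.

(** * Merging cycles down to a full cycle *)

(** When all elements of E have at least two cycles, the branch of [Defs.next]
    that keeps full cycles is empty, so every element really loses a cycle. *)
Lemma next_sub (n k : nat) (E : {set 'S_n}) :
  (forall s : 'S_n, s \in E -> ncycles s = k.+2) ->
  forall s : 'S_n, s \in Defs.next E -> ncycles s = k.+1.
Proof.
move=> Ek s; rewrite !inE => /orP[|/andP[/Ek -> //]].
move=> /existsP[r /andP[/Ek rk /existsP[i /existsP[j /and3P[_ _ /eqP ->]]]]].
by rewrite rk.
Qed.

Lemma ncycles_merge (n : nat) (s : 'S_n) (i j : 'I_n) :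
  i \notin porbit s j -> ncycles (compp s (tperm i j)) = (ncycles s).-1.
Proof.
move=> ij; have := porbits_mul_tperm s i j; rewrite /ncycles /compp /= ij.
have -> : i != j by apply: contraNneq ij => ->; exact: porbit_id.
by rewrite addn2 addn1 => -[<-].
Qed.

(** As long as there are two orbits, the transposition of one point from each
    merges them. *)
Lemma next_neq0 (n : nat) (E : {set 'S_n}) :
  (0 < n)%N -> E != finset.set0 -> Defs.next E != finset.set0.
Proof.
move=> n0 /set0Pn[s sE]; apply/set0Pn.
have [s1|s1] := eqVneq (ncycles s) 1%N.
  by exists s; rewrite !inE sE s1 eqxx orbT.
have [i [j ij]] : exists i j, i \notin porbit s j.
  apply: contra_neqP s1 => /forallNP si; have j := Ordinal n0.
  apply/eqP/cards1P; exists (porbit s j); apply/setP => A; rewrite !inE.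
  apply/imsetP/eqP => [[i _ ->]|->]; last by exists j.
  by apply/eqP; rewrite eq_porbit_mem; apply: contraT => ?; case: (si i); exists j.
exists (compp s (tperm i j)); rewrite !inE; apply/orP; left.
apply/existsP; exists s; rewrite sE /=.
apply/existsP; exists i; apply/existsP; exists j.
rewrite ncycles_merge// !eqxx !andbT.
by apply: contraNneq ij => ->; exact: porbit_id.
Qed.

Lemma ncycles_gt0 (n : nat) (s : 'S_n) : (0 < n)%N -> (0 < ncycles s)%N.
Proof.
case: n s => // n s _; rewrite card_gt0; apply/set0Pn.
by exists (porbit s ord0); exact: imset_f.
Qed.

Lemma final_full_cycle (n : nat) (s r : 'S_n) :
  (0 < n)%N -> r \in final s -> ncycles r = 1%N.
Proof.
move=> /(ncycles_gt0 s); rewrite /final.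
case: (ltnP 1) => [|s1 s0]; last first.
  by rewrite inE => /eqP ->; apply/eqP; rewrite eqn_leq s1.
move=> _ s0.
have : forall r : 'S_n, r \in [set s]%SET -> ncycles r = (ncycles s).-1.+1.
  by move=> ? /set1P ->; rewrite prednK.
elim: (ncycles s).-1 [set s]%SET => [E /[apply] //|k IH E Ek].
by rewrite iterSr; apply: IH; exact: next_sub.
Qed.

Lemma final_neq0 (n : nat) (s : 'S_n) : (0 < n)%N -> final s != finset.set0.
Proof.
have E0 : [set s]%SET != finset.set0 by apply/set0Pn; exists s; rewrite inE.
move=> n0; rewrite /final; case: ifP => // _.
by elim: (_.-1) => //= k; exact: next_neq0.
Qed.

Lemma nextJ (n : nat) (E : {set 'S_n}) (t : 'S_n) :
  Defs.next (E :^ t)%g = (Defs.next E :^ t)%g.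
Proof.
wlog suff: E t / (Defs.next E :^ t \subset Defs.next (E :^ t))%g.
  move=> H; apply/eqP; rewrite finset.eqEsubset H andbT.
  by rewrite -sub_conjgV (fintype.subset_trans (H _ _))// conjsgK.
apply/fintype.subsetP => _ /imsetP[s + ->]; rewrite !inE => /orP[|]; last first.
  by move=> /andP[sE s1]; rewrite memJ_conjg sE ncyclesJ s1 orbT.
move=> /existsP[r /andP[rE /existsP[i /existsP[j /and3P[ij /eqP -> ncr]]]]].
apply/orP; left; apply/existsP; exists (r ^ t)%g; rewrite memJ_conjg rE /=.
apply/existsP; exists (t i); apply/existsP; exists (t j).
by rewrite (inj_eq perm_inj) ij !ncyclesJ ncr /compp conjMg tpermJ eqxx.
Qed.

Lemma finalJ (n : nat) (s t : 'S_n) : final (s ^ t)%g = (final s :^ t)%g.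
Proof.
rewrite /final ncyclesJ; case: ifP => _; last by rewrite conjg_set1.
by elim: (_.-1) => /= [|k ->]; rewrite ?conjg_set1 ?nextJ.
Qed.

(** * The coupling through a uniform full cycle *)

(** The transition kernel that picks an element of [final s] uniformly. *)
Definition final_kernel (R : realType) (n : nat) (s r : 'S_n) : R :=
  (r \in final s)%:R / #|final s|%:R.

Definition conj_inv_mass (R : realType) (n : nat) (q : 'S_n -> R) : Prop :=
  [/\ forall s, 0 <= q s, \sum_s q s = 1 & forall s t, q (s ^ t)%g = q s].

(** With C the set of full cycles, the glueing of the two couplings
    q(s) K(s, r) and q'(s') K(s', r) along their common second marginal, the
    uniform law on C: s and s' are drawn independently given r. The
    factor |C| is the inverse of the mass that this marginal gives to r. *)
Definition final_coupling (R : realType) (n : nat) (q q' : 'S_n -> R)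
    (s s' : 'S_n) : R :=
  #|[pred r : 'S_n | ncycles r == 1%N]|%:R *
  \sum_r (q s * final_kernel R s r) * (q' s' * final_kernel R s' r).

Lemma final_kernel_ge0 (R : realType) (n : nat) (s r : 'S_n) :
  0 <= final_kernel R s r.
Proof. by rewrite divr_ge0 ?ler0n. Qed.

Lemma sum_final_kernel (R : realType) (n : nat) (s : 'S_n) :
  (0 < n)%N -> \sum_r final_kernel R s r = 1.
Proof.
move=> n0; rewrite -mulr_suml -natr_sum (_ : (\sum_r _)%N = #|final s|); last first.
  by rewrite -sum1_card [RHS]big_mkcond; apply: eq_bigr => r _; case: ifP.
by rewrite divff// pnatr_eq0 -lt0n card_gt0 final_neq0.
Qed.

Lemma final_kernelJ (R : realType) (n : nat) (s r t : 'S_n) :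
  final_kernel R (s ^ t)%g (r ^ t)%g = final_kernel R s r.
Proof. by rewrite /final_kernel finalJ memJ_conjg cardJg. Qed.

Lemma final_kernel_neq0 (R : realType) (n : nat) (s r : 'S_n) :
  final_kernel R s r != 0 -> r \in final s.
Proof. by apply: contraNT => /negbTE rs; rewrite /final_kernel rs mul0r. Qed.

(** Starting from a conjugation invariant mass function, a uniform point of
    [final s] is uniform on the full cycles: its mass function is conjugation
    invariant, hence constant on the single conjugacy class that carries it. *)
Lemma sum_mass_final_kernel (R : realType) (n : nat) (q : 'S_n -> R) (r : 'S_n) :
  (0 < n)%N -> conj_inv_mass q ->
  #|[pred r : 'S_n | ncycles r == 1%N]|%:R * \sum_s q s * final_kernel R s r
    = (ncycles r == 1%N)%:R.
Proof.
move=> n0 [q0 q1 qJ]; pose w r := \sum_s q s * final_kernel R s r.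
have wJ r' t : w (r' ^ t)%g = w r'.
  rewrite /w (reindex_inj (conjg_inj t)); apply: eq_bigr => s _.
  by rewrite qJ final_kernelJ.
have w0 r' : ncycles r' != 1%N -> w r' = 0.
  move=> r'1; apply: big1 => s _; apply/eqP; rewrite mulf_eq0 orbC.
  apply/orP; left; apply: contraNT r'1 => /final_kernel_neq0.
  by move=> /(final_full_cycle n0) ->.
have w1 : \sum_r' w r' = 1.
  rewrite exchange_big /= -[RHS]q1; apply: eq_bigr => s _.
  by rewrite -mulr_sumr sum_final_kernel// mulr1.
rewrite -/(w r); have [r1|/w0 ->] := eqVneq (ncycles r) 1%N; last by rewrite mulr0.
rewrite -[RHS]w1 (bigID (fun r => ncycles r == 1%N)) /= [X in _ + X]big1 ?addr0//.
rewrite (eq_bigr (fun=> w r)) => [|r' /eqP r'1].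
  by rewrite sumr_const mulr_natl.
by have [t ->] := full_cycle_conj r1 r'1.
Qed.

Lemma final_coupling_ge0 (R : realType) (n : nat) (q q' : 'S_n -> R) s s' :
  conj_inv_mass q -> conj_inv_mass q' -> 0 <= final_coupling q q' s s'.
Proof.
move=> [q0 _ _] [q'0 _ _]; rewrite mulr_ge0 ?ler0n// sumr_ge0// => r _.
by rewrite !mulr_ge0// final_kernel_ge0.
Qed.

Lemma final_couplingC (R : realType) (n : nat) (q q' : 'S_n -> R) s s' :
  final_coupling q q' s s' = final_coupling q' q s' s.
Proof. by congr (_ * _); apply: eq_bigr => r _; rewrite mulrC. Qed.

(** Summing over s' leaves q(s) K(s, r) times the indicator that r is a full
    cycle, which holds wherever K(s, r) does not vanish. *)
Lemma final_coupling_marginal (R : realType) (n : nat) (q q' : 'S_n -> R) s :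
  (0 < n)%N -> conj_inv_mass q' -> \sum_s' final_coupling q q' s s' = q s.
Proof.
move=> n0 q'P; rewrite -mulr_sumr exchange_big /= mulr_sumr.
under eq_bigr => r _ do
  rewrite -mulr_sumr mulrCA sum_mass_final_kernel// -mulrA.
rewrite -mulr_sumr (eq_bigr (final_kernel R s)) ?sum_final_kernel ?mulr1// => r _.
have [->|] := eqVneq (final_kernel R s r) 0; first by rewrite mul0r.
by move=> /final_kernel_neq0/(final_full_cycle n0) ->; rewrite eqxx mulr1.
Qed.

Lemma final_coupling_neq0 (R : realType) (n : nat) (q q' : 'S_n -> R) s s' :
  final_coupling q q' s s' != 0 -> exists2 r, r \in final s & r \in final s'.
Proof.
move=> J0; have [r] : exists r,
    q s * final_kernel R s r * (q' s' * final_kernel R s' r) != 0.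
  apply: contra_neqP J0 => /forallNP J0; rewrite /final_coupling big1 ?mulr0//.
  by move=> r _; apply/eqP; apply: contraT => /J0.
move=> J0'; exists r; apply: (@final_kernel_neq0 R);
  by apply: contra_neq J0' => ->; rewrite !(mulr0, mul0r).
Qed.

(** Integrate g s <= h s + l s' against the coupling, which charges only the
    pairs for which the inequality is available. *)
Lemma final_transfer (R : realType) (n : nat) (q q' g h l : 'S_n -> R) :
  (0 < n)%N -> conj_inv_mass q -> conj_inv_mass q' ->
  (forall s s' r, r \in final s -> r \in final s' -> g s <= h s + l s') ->
  \sum_s q s * g s <= \sum_s q s * h s + \sum_s q' s * l s.
Proof.
move=> n0 qP q'P ghl; pose J := final_coupling q q'.
have JE k : \sum_s q s * k s = \sum_s \sum_s' J s s' * k s.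
  by apply: eq_bigr => s _; rewrite -mulr_suml final_coupling_marginal.
have JE' k : \sum_s q' s * k s = \sum_s \sum_s' J s s' * k s'.
  rewrite exchange_big; apply: eq_bigr => s' _; rewrite -mulr_suml; congr (_ * _).
  under eq_bigr => s _ do rewrite /J final_couplingC.
  by rewrite final_coupling_marginal.
rewrite !JE JE' -big_split; apply: ler_sum => s _; rewrite -big_split /=.
apply: ler_sum => s' _; rewrite -mulrDr.
have [->|J0] := eqVneq (J s s') 0; first by rewrite !mul0r.
have [r rs rs'] := final_coupling_neq0 J0.
by rewrite ler_wpM2l ?final_coupling_ge0//; exact: ghl rs rs'.
Qed.

(** * Laws of random permutations *)

Definition perm_law (R : realType) (d : measure_display) (T : measurableType d)
    (P : probability T R) (n : nat) (X : T -> 'S_n) (s : 'S_n) : R :=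
  fine (P (X @^-1` [set s])).

Lemma measurable_perm_preimage (d : measure_display) (T : measurableType d)
    (n : nat) (X : {mfun T >-> 'S_n}) (A : set 'S_n) :
  measurable (X @^-1` A).
Proof.
by rewrite -[Y in measurable Y]setTI; exact: (@measurable_funPT _ _ _ _ X).
Qed.

Lemma perm_lawE (R : realType) (d : measure_display) (T : measurableType d)
    (P : probability T R) (n : nat) (X : {mfun T >-> 'S_n}) (s : 'S_n) :
  (perm_law P X s)%:E = P (X @^-1` [set s]).
Proof.
rewrite /perm_law fineK// fin_num_measure//.
exact: measurable_perm_preimage.
Qed.

Lemma integral_perm (R : realType) (d : measure_display) (T : measurableType d)
    (P : probability T R) (n : nat) (X : {mfun T >-> 'S_n}) (G : 'S_n -> R) :
  (forall s, 0 <= G s) ->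
  (\int[P]_w (G (X w))%:E = (\sum_s perm_law P X s * G s)%:E)%E.
Proof.
move=> G0; have mX s := measurable_perm_preimage X [set s].
have m1 s : measurable_fun setT (EFin \o (\1_(X @^-1` [set s]) : T -> R)).
  exact/measurable_EFinP/measurable_indic.
under eq_integral => w _.
  rewrite (_ : (G (X w))%:E =
      \sum_s ((G s)%:E * (\1_(X @^-1` [set s]) w)%:E)%E); last first.
    rewrite (bigD1 (X w)) //= big1 ?adde0.
      by rewrite indicE mem_set// mule1.
    by move=> s /eqP sX; rewrite indicE memNset ?mule0//= => /esym.
  over.
rewrite ge0_integral_sum//=; last 2 first.
- by move=> s; apply: measurable_funeM; exact: m1.
- by move=> s w _; rewrite mule_ge0 ?lee_fin.
rewrite -sumEFin; apply: eq_bigr => s _.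
rewrite ge0_integralZl_EFin//; last exact: m1.
by rewrite integral_indic// setIT EFinM (perm_lawE P X) muleC.
Qed.

Lemma prob_perm (R : realType) (d : measure_display) (T : measurableType d)
    (P : probability T R) (n : nat) (X : {mfun T >-> 'S_n}) (A : pred 'S_n) :
  (P [set w | A (X w)] = \int[P]_w (A (X w))%:R%:E)%E.
Proof.
rewrite -[in LHS](setIT [set w | A (X w)]) -integral_indic//; last first.
  exact: (measurable_perm_preimage X [set s | A s]).
apply: eq_integral => w _; rewrite indicE; congr ((nat_of_bool _)%:R%:E).
by apply/idP/idP => [/set_mem|/mem_set].
Qed.

(** Evaluating the equality of the two measures at the singleton of s gives
    that X = s and t X t^-1 = s are equally likely. *)
Lemma perm_law_conj_inv (R : realType) (d : measure_display) (T : measurableType d)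
    (P : probability T R) (n : nat) (X : {mfun T >-> 'S_n}) :
  (forall s : 'S_n, pushforward P (fun w => compp (compp s^-1%g (X w)) s)
    = distribution P X) ->
  conj_inv_mass (perm_law P X).
Proof.
move=> PX; split=> [s||s t].
- by rewrite fine_ge0.
- apply: EFin_inj; have := integral_perm P X (fun=> ler01).
  rewrite integral_cst// mul1e => PT; apply: etrans (probability_setT P).
  by rewrite PT; congr EFin; apply: eq_bigr => s _; rewrite mulr1.
- have /(congr1 (fun m => fine (m [set s]))) := PX t.
  rewrite /perm_law /distribution /pushforward => <-; congr (fine (P _)).
  apply/seteqP; split => w /=; rewrite /compp /conjg.
    by move=> ->; rewrite !mulgA mulgV mul1g mulgK.
  by move=> <-; rewrite !mulgA mulVg mul1g mulgKV.
Qed.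

(** The right-hand side has one term at X and two at X', matching the three
    terms of [mdist_common_final]. *)
Lemma integral_transfer (R : realType) (d d' : measure_display)
    (T : measurableType d) (T' : measurableType d')
    (P : probability T R) (P' : probability T' R) (n : nat)
    (X : {mfun T >-> 'S_n}) (X' : {mfun T' >-> 'S_n}) (c : R)
    (g h l m : 'S_n -> R) :
  (0 < n)%N ->
  conj_inv_mass (perm_law P X) -> conj_inv_mass (perm_law P' X') ->
  (forall s, 0 <= g s) -> (forall s, 0 <= h s) ->
  (forall s, 0 <= l s) -> (forall s, 0 <= m s) ->
  (forall s s' r, r \in final s -> r \in final s' ->
     g s <= c * (h s + (l s' + m s'))) ->
  (\int[P]_w (g (X w))%:E <=
     c%:E * (\int[P]_w (h (X w))%:E +
       (\int[P']_w (l (X' w))%:E + \int[P']_w (m (X' w))%:E)))%E.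
Proof.
move=> n0 XP X'P g0 h0 l0 m0 ghlm.
rewrite !integral_perm// -!EFinD -EFinM lee_fin.
have := final_transfer (g := g) (h := fun s => c * h s)
  (l := fun s => c * (l s + m s)) n0 XP X'P.
under [X in _ + X]eq_bigr => s _ do rewrite mulrCA mulrDr.
under [X in X + _]eq_bigr => s _ do rewrite mulrCA.
rewrite -!mulr_sumr big_split /= -mulrDr; apply => s s' r rs rs'.
by rewrite -mulrDr; exact: ghlm rs rs'.
Qed.

(** * Comparing values of f through a common final permutation *)

Lemma eps'_ge0 (R : realType) (F : metricType R) (f : forall n, 'S_n -> F)
    (n k : nat) : 0 <= eps' f n k.
Proof. exact: bigmax_ge_id. Qed.

Lemma mdist_final_le (R : realType) (F : metricType R)
    (f : forall n, 'S_n -> F) (n : nat) (s r : 'S_n) :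
  r \in final s -> mdist (f n s) (f n r) <= eps' f n (ncycles s).
Proof.
move=> rs.
apply: (@le_trans _ _ (\big[Num.max/0]_(r' in final s) mdist (f n s) (f n r'))).
  exact: (@le_bigmax_cond _ _ _ _ r).
exact: (@le_bigmax_cond _ _ _ _ s
  _ (fun s' : 'S_n => \big[Num.max/0]_(r' in final s') mdist (f n s') (f n r'))).
Qed.

(** Go from f s to f r to f s' to x. *)
Lemma mdist_common_final (R : realType) (F : metricType R)
    (f : forall n, 'S_n -> F) (x : F) (n : nat) (s s' r : 'S_n) :
  r \in final s -> r \in final s' ->
  mdist (f n s) x <= eps' f n (ncycles s) + eps' f n (ncycles s')
                     + mdist (f n s') x.
Proof.
move=> /(mdist_final_le f) rs /(mdist_final_le f) rs'.
rewrite -addrA; apply: le_trans (metric_triangle _ (f n r) _) _; rewrite lerD//.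
by apply: le_trans (metric_triangle _ (f n s') _) _; rewrite lerD// metric_sym.
Qed.

(** * Convergence to zero *)

Lemma poweR_cvg0 (R : realType) (u : (\bar R)^nat) (a : R) : 0 < a ->
  (forall n, 0 <= u n)%E -> u @ \oo --> 0%E -> (fun n => u n `^ a)%E @ \oo --> 0%E.
Proof.
move=> a0 u0 /fine_cvgP[ufin /cvgr0Pnorm_lt ucvg].
apply/fine_cvgP; split.
  by near do rewrite fin_num_poweR//; exact: ufin.
apply/cvgr0Pnorm_lt => e e0; have b0 : 0 < e `^ a^-1 by rewrite powR_gt0.
near=> n.
have un : u n \is a fin_num by near: n.
have : `|fine (u n)| < e `^ a^-1 by near: n; exact: ucvg.
rewrite /= -(fineK un) poweR_EFin /= !ger0_norm ?powR_ge0 ?fine_ge0// => une.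
have -> : e = (e `^ a^-1) `^ a by rewrite -powRrM mulVf ?gt_eqF// powRr1// ltW.
by rewrite gt0_ltr_powR// ?nnegrE ?fine_ge0 ?powR_ge0.
Unshelve. all: by end_near. Qed.

(** The sum is at most three times its largest term. *)
Lemma powRD_le3 (R : realType) (p a b c : R) : 0 <= p ->
  0 <= a -> 0 <= b -> 0 <= c ->
  (a + b + c) `^ p <= 3 `^ p * (a `^ p + b `^ p + c `^ p).
Proof.
move=> p0 a0 b0 c0; pose m := Num.max a (Num.max b c).
have m0 : 0 <= m by rewrite le_max a0.
have abc : a + b + c <= 3 * m.
  have : a <= m by rewrite le_max lexx.
  have : b <= m by rewrite !le_max lexx orbT.
  have : c <= m by rewrite !le_max lexx !orbT.
  lra.
apply: (@le_trans _ _ ((3 * m) `^ p)).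
  by apply: ge0_ler_powR; rewrite ?nnegrE ?addr_ge0 ?mulr_ge0.
rewrite powRM// ler_wpM2l ?powR_ge0// /m.
have pa := powR_ge0 a p; have pb := powR_ge0 b p; have pc := powR_ge0 c p.
by case: (leP a) => _; [case: (leP b) => _|]; lra.
Qed.

(** The bound is asked only for n > 0 because 'S_0 has no full cycle, so the
    coupling exists from n = 1 on. *)
Lemma squeeze_ge0_cvge0 (R : realType) (u v : (\bar R)^nat) :
  (forall n, 0 <= u n)%E -> (forall n, (0 < n)%N -> u n <= v n)%E ->
  v @ \oo --> 0%E -> u @ \oo --> 0%E.
Proof.
move=> u0 uv v0; apply: (squeeze_cvge _ (cvg_cst 0%E) v0).
by exists 1%N => // n /= n0; rewrite u0 uv.
Qed.

Lemma cvg0D3e (R : realType) (u v w : (\bar R)^nat) :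
  u @ \oo --> 0%E -> v @ \oo --> 0%E -> w @ \oo --> 0%E ->
  (fun n => u n + (v n + w n))%E @ \oo --> 0%E.
Proof.
move=> u0 v0 w0; rewrite -[0%E in X in _ --> X]adde0; apply: cvgeD => //.
by rewrite -[0%E in X in _ --> X]adde0; apply: cvgeD.
Qed.

Lemma powR_Lnorm_fin (R : realType) (d : measure_display)
    (T : measurableType d) (P : probability T R) (Y : T -> R) (p : R) :
  p != 0 -> (forall w, 0 <= Y w) ->
  ('N[P]_(p%:E)[EFin \o Y] `^ p = \int[P]_w (Y w `^ p)%:E)%E.
Proof.
move=> p0 Y0; rewrite poweR_Lnorm//; apply: eq_integral => w _.
by rewrite /= ger0_norm.
Qed.

(** Passing to the p-th moment replaces Minkowski's inequality by the pointwise
    inequality [powRD_le3], which fits the transfer of integrals. *)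
Lemma cvg0_in_LpP (R : realType) (d : nat -> measure_display)
    (T : forall n, measurableType (d n)) (P : forall n, probability (T n) R)
    (p : R) (Y : forall n, T n -> R) :
  0 < p -> (forall n w, 0 <= Y n w) ->
  cvg0_in_Lp P p Y <->
  (fun n => \int[P n]_w (Y n w `^ p)%:E)%E @ \oo --> 0%E.
Proof.
move=> p0 Y0; rewrite /cvg0_in_Lp; under [X in _ <-> X @ _ --> _]eq_fun => n.
  rewrite -powR_Lnorm_fin ?gt_eqF//; over.
split=> [|/poweR_cvg0 H]; first by apply: poweR_cvg0 => // n; exact: Lnorm_ge0.
have := H p^-1; rewrite invr_gt0 => /(_ p0 (fun=> poweR_ge0 _ _)).
under eq_fun => n do rewrite -poweRrM mulfV ?gt_eqF// poweRe1 ?Lnorm_ge0//.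
by [].
Qed.

Theorem theorem1 (R : realType) (F : metricType R) (f : forall n, 'S_n -> F)
    (d d' : nat -> measure_display)
    (T : forall n, measurableType (d n)) (T' : forall n, measurableType (d' n))
    (P : forall n, probability (T n) R) (P' : forall n, probability (T' n) R)
    (sigma : forall n, {mfun T n >-> 'S_n})
    (sigma_ref : forall n, {mfun T' n >-> 'S_n}) (x : F) :
  conj_invariant P sigma -> conj_invariant P' sigma_ref ->
  (cvg0_in_prob P' (fun n w => mdist (f n (sigma_ref n w)) x) ->
   cvg0_in_prob P' (fun n w => eps' f n (ncycles (sigma_ref n w))) ->
   cvg0_in_prob P (fun n w => eps' f n (ncycles (sigma n w))) ->
   cvg0_in_prob P (fun n w => mdist (f n (sigma n w)) x))
  /\
  (forall p : R, 1 <= p ->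
   cvg0_in_Lp P' p (fun n w => mdist (f n (sigma_ref n w)) x) ->
   cvg0_in_Lp P' p (fun n w => eps' f n (ncycles (sigma_ref n w))) ->
   cvg0_in_Lp P p (fun n w => eps' f n (ncycles (sigma n w))) ->
   cvg0_in_Lp P p (fun n w => mdist (f n (sigma n w)) x)).
Proof.
move=> sigmaJ refJ.
have qP n : (0 < n)%N -> conj_inv_mass (perm_law (P n) (sigma n)).
  by move=> n0; apply: perm_law_conj_inv => s; exact: sigmaJ.
have qP' n : (0 < n)%N -> conj_inv_mass (perm_law (P' n) (sigma_ref n)).
  by move=> n0; apply: perm_law_conj_inv => s; exact: refJ.
pose D n (s : 'S_n) := mdist (f n s) x.
pose e n (s : 'S_n) := eps' f n (ncycles s).
have D0 n s : 0 <= @D n s by exact: mdist_ge0.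
have e0 n s : 0 <= @e n s by exact: eps'_ge0.
split=> [ref_x ref_e sigma_e eta eta0|p p1].
- have eta3 : 0 < eta / 3 by rewrite divr_gt0.
  have := cvg0D3e (sigma_e _ eta3) (ref_e _ eta3) (ref_x _ eta3).
  apply: squeeze_ge0_cvge0 => // n n0.
  rewrite (prob_perm (P n) (sigma n) (fun s => `|D n s| > eta)).
  rewrite (prob_perm (P n) (sigma n) (fun s => `|e n s| > eta / 3)).
  rewrite (prob_perm (P' n) (sigma_ref n) (fun s => `|e n s| > eta / 3)).
  rewrite (prob_perm (P' n) (sigma_ref n) (fun s => `|D n s| > eta / 3)).
  (* If the left indicator is 1, one of the three summands of the bound on
     d(f s, x) exceeds eta / 3. *)
  rewrite -[leRHS]mul1e.
  apply: (integral_transfer (c := 1) (g := fun s => (eta < `|D n s|)%R%:R)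
    (h := fun s => (eta / 3 < `|e n s|)%R%:R)
    (l := fun s => (eta / 3 < `|e n s|)%R%:R)
    (m := fun s => (eta / 3 < `|D n s|)%R%:R) n0 (qP n n0) (qP' n n0)) => //.
  move=> s s' r rs rs'; have := mdist_common_final f x rs rs'.
  rewrite -/(D n s) -/(e n s) -/(e n s') -/(D n s') !ger0_norm//.
  case: (ltP eta) => ?; case: (ltP _ (e n s)) => ?; case: (ltP _ (e n s')) => ?;
    by case: (ltP _ (D n s')) => ? ?; rewrite /= ?mulr0n ?mulr1n; lra.
- have p0 : 0 < p by exact: lt_le_trans p1.
  move=> /(cvg0_in_LpP _ p0 (fun n w => D0 n _)) ref_x.
  move=> /(cvg0_in_LpP _ p0 (fun n w => e0 n _)) ref_e.
  move=> /(cvg0_in_LpP _ p0 (fun n w => e0 n _)) sigma_e.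
  apply/(cvg0_in_LpP _ p0 (fun n w => D0 n _)).
  have /(cvgeZl (y := (3 `^ p)%:E) isT) := cvg0D3e sigma_e ref_e ref_x.
  rewrite mule0; apply: squeeze_ge0_cvge0 => [n|n n0].
    by apply: integral_ge0 => w _; rewrite lee_fin powR_ge0.
  apply: (integral_transfer (g := fun s => D n s `^ p)
    (h := fun s => e n s `^ p) (l := fun s => e n s `^ p)
    (m := fun s => D n s `^ p) n0 (qP n n0) (qP' n n0)) => [s|s|s|s|s s' r rs rs'];
    rewrite ?powR_ge0// addrA.
  apply: le_trans (powRD_le3 _ _ _ _); rewrite ?(ltW p0)//.
  apply: ge0_ler_powR; rewrite ?(ltW p0) ?nnegrE ?addr_ge0//.
  exact: mdist_common_final rs rs'.
Qed.
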